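(* Let $\mathfrak A$ be a Hausdorff topological Abelian group, $\mu$ be an $\mathfrak A$-valued $\sigma$-content, and $\mathcal N$ be a completion ring for $\mu$. If $\mathcal N$ is $\mu$-regular, then $\mathfrak{C}_{\mathcal N}\mu$ is an $\mathfrak A$-valued $\sigma$-content.
   Context: $D_\mu$, $R_\mu$ denote the domain and range of a map $\mu$; all maps $\mu$ here have as domain a set of sets. Countable means finite or countably infinite. A ring (of sets) is a nonempty set of sets closed under union $A\cup B$ and difference $A\setminus B$. A partition of a set $A$ is a family of pairwise disjoint (possibly empty) sets, indexed by a set $I$, whose union is $A$; it is countable if $I$ is countable. A family $f\colon I\to\mathfrak A$ is summable if the net $J\mapsto\sum_{i\in J}f(i)$ over finite subsets $J\subset I$ converges in $\mathfrak A$; the limit is $\sum_{i\in I}f(i)$. An $\mathfrak A$-valued $\sigma$-content is a map $\mu$ such that $D_\mu$ is a ring, $R_\mu\subset\mathfrak A$, and for every $A\in D_\mu$ and every countable partition $\mathbf A\colon I\to D_\mu$ of $A$ the family $\mu\circ\mathbf A$ is summable with $\mu(A)=\sum_{i\in I}\mu(\mathbf A(i))$. For a set of sets $\mathcal K$, $\hat{\mathcal K}=\{A: A\subset B\text{ for some }B\in\mathcal K\}$. $A\Delta B=(A\setminus B)\cup(B\setminus A)$. For a map $\mu$ with $\varnothing\in D_\mu$, a set $N\in D_\mu$ is $\mu$-null if $\mu(N')=\mu(\varnothing)$ for every $N'\in D_\mu$ with $N'\subset N$; $\mathcal N_\mu$ is the set of all $\mu$-null sets. A set of sets $\mathcal N$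 is $\mu$-regular if $\mathcal N\cap\hat D_\mu\subset\hat{\mathcal N}_\mu$. The map $\mu$ admits completion if $D_\mu$ is a ring and $\mu(B_1)=\mu(B_2)$ for all $B_1,B_2\in D_\mu$ with $B_1\Delta B_2\in\mathcal N_\mu$ (every group-valued content, hence every $\sigma$-content, admits completion). If $\mu$ admits completion, a completion ring for $\mu$ is a ring $\mathcal N$ such that $N\cap B\in\mathcal N$ for all $N\in\mathcal N$, $B\in D_\mu$, and $\mathcal N\cap D_\mu=\mathcal N_\mu$. For sets of sets $\mathcal Q,\mathcal N$, $\Delta(\mathcal Q,\mathcal N)=\{A: A\Delta B\in\mathcal N\text{ for some }B\in\mathcal Q\}$. The $\mathcal N$-completion $\mathfrak C_{\mathcal N}\mu$ is the unique (well-defined) map $\nu$ with $D_\nu=\Delta(D_\mu,\mathcal N)$ and $\nu(A)=\mu(B)$ whenever $A\in D_\nu$, $B\in D_\mu$, $A\Delta B\in\mathcal N$. *)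

(* Defs.v *)
From HB Require Import structures.
From mathcomp Require Import all_boot all_order all_algebra finmap.
From mathcomp Require Import all_classical all_reals all_analysis.
From mathcomp.analysis.showcase Require summability.

Set Implicit Arguments.
Unset Strict Implicit.
Unset Printing Implicit Defensive.

Import Order.TTheory GRing.Theory.

Local Open Scope classical_set_scope.
Local Open Scope ring_scope.

(* A map whose domain [dom mu] is a set of subsets of [T]. The underlying
   function is total; its values outside [dom mu] are junk, and every notion
   below only looks at values on the domain. *)
Record setmap (T V : Type) := SetMap {
  dom : set (set T);
  setmap_fun :> set T -> V
}.

(* [summability.totally] is the filter on [{fset I}] generated by the sets
   [[set J | J0 `<=` J]], so this is convergence to [s] of the net of finite
   partial sums of [f]. In a Hausdorff group this says that [f] is
   summable with sum [s]. *)
Definition sums_to (V : topologicalZmodType) (I : choiceType) (f : I -> V)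
    (s : V) : Prop :=
  \sum_(i <- J) f i @[J --> @summability.totally I] --> s.

Definition family_partition (T I : Type) (P : I -> set T) (A : set T) : Prop :=
  trivIset [set: I] P /\ \bigcup_i P i = A.

(* Countable index sets, finite and empty ones included, are rendered by
   [countType]. *)
Definition sigma_content (T : Type) (V : topologicalZmodType)
    (mu : setmap T V) : Prop :=
  setring (dom mu) /\
  forall (A : set T) (I : countType) (P : I -> set T),
    dom mu A -> (forall i, dom mu (P i)) -> family_partition P A ->
    sums_to (fun i => mu (P i)) (mu A).

Section completion.
Context {T V : Type}.
Implicit Types (mu : setmap T V) (K N Q : set (set T)).

Definition hat K : set (set T) := [set A | exists2 B, K B & A `<=` B].

Definition null_sets mu : set (set T) :=
  [set M | dom mu M /\
    forall M', dom mu M' -> M' `<=` M -> mu M' = mu set0].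

Definition regular mu N : Prop := N `&` hat (dom mu) `<=` hat (null_sets mu).

Definition admits_completion mu : Prop :=
  setring (dom mu) /\
  forall B1 B2, dom mu B1 -> dom mu B2 -> null_sets mu (B1 `+` B2) ->
    mu B1 = mu B2.

Definition completion_ring mu N : Prop :=
  [/\ setring N,
      forall M B, N M -> dom mu B -> N (M `&` B) &
      N `&` dom mu = null_sets mu].

Definition Delta Q N : set (set T) := [set A | exists2 B, Q B & N (A `+` B)].

(* The value at [A] is [mu B] for a chosen [B] in [dom mu] with [A `+` B] in
   [N]; by [completionE] below it does not depend on the choice. *)
Definition completion mu N : setmap T V :=
  SetMap (Delta (dom mu) N)
    (fun A => mu (xget set0 [set B | dom mu B /\ N (A `+` B)])).

Lemma setring_setY (R : set (set T)) A B :
  setring R -> R A -> R B -> R (A `+` B).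
Proof.
by case=> _ RU RD RA RB; rewrite setY_def; apply: RU; exact: RD.
Qed.

Lemma completionE mu N A B : admits_completion mu -> completion_ring mu N ->
  dom mu B -> N (A `+` B) -> completion mu N A = mu B.
Proof.
move=> [rD mu_eq] [rN _ ND] DB NAB /=.
case: xgetP => [C _ [DC NAC]|/(_ B)]; last by case.
apply: mu_eq => //; rewrite -ND; split; last exact: setring_setY.
have -> : C `+` B = (A `+` C) `+` (A `+` B).
  by rewrite (setYC A C) setYA -(setYA C A A) setYK setY0.
exact: setring_setY.
Qed.

End completion.

Lemma sums_to_finType (V : topologicalZmodType) (I : finType) (f : I -> V)
    (s : V) :
  hausdorff_space V -> sums_to f s -> s = \sum_(i : I) f i.
Proof.
move=> hV fs; apply: hV => A B sA sumB.
have [J _ JA] := fs _ sA.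
pose F := [fset i | i in I]%fset.
exists (\sum_(i : I) f i); split; last exact: nbhs_singleton.
have FT i : i \in F by apply/imfsetP; exists i.
have -> : \sum_(i : I) f i = \sum_(i <- F) f i.
  apply: perm_big; apply: uniq_perm.
  - exact: index_enum_uniq.
  - exact: fset_uniq.
  - by move=> i; rewrite mem_index_enum FT.
by apply: JA => /=; apply/fsubsetP => i _.
Qed.

Lemma sigma_content_admits_completion (T : Type) (V : topologicalZmodType)
    (mu : setmap T V) :
  hausdorff_space V -> sigma_content mu -> admits_completion mu.
Proof.
move=> hV [rD mu_sum]; split=> // B1 B2 DB1 DB2 [_ null].
have [D0 _ DmD] := rD.
have mu0 : mu set0 = 0.
  have /(sums_to_finType hV) -> : sums_to (fun i : void => mu set0) (mu set0).
    apply: (mu_sum set0 void (fun=> set0)) => //; split; first by case.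
    by apply/seteqP; split=> // x [].
  by rewrite big1 //; case.
have mu_diff A B : dom mu A -> dom mu B -> A `\` B `<=` B1 `+` B2 ->
    mu A = mu (A `&` B).
  move=> DA DB AB.
  have DI : dom mu (A `&` B) by rewrite -setDD; exact/DmD/DmD.
  have /(sums_to_finType hV) -> : sums_to
      (fun b : bool => mu (if b then A `&` B else A `\` B)) (mu A).
    apply: mu_sum => //; first by case=> //; exact: DmD.
    split=> [[] [] _ _ [x [] /= [Ax Bx] []]//|].
    apply/seteqP; split=> [x [[] _ []]//|x Ax].
    by case: (pselect (B x)) => Bx; [exists true|exists false].
  by rewrite big_bool /= (null (A `\` B)) ?mu0 ?addr0 //; exact: DmD.
rewrite (mu_diff B1 B2) ?(mu_diff B2 B1) // 1?[in RHS]setIC // setY_def.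
- exact: subsetUr.
- exact: subsetUl.
Qed.

(* Main.v *)
Require Import Defs.
From mathcomp Require Import all_boot all_order all_algebra.
From mathcomp Require Import all_classical all_reals all_analysis.

(** Let [nu] be the completion and call [B] in [dom mu] a version of [A] when
    [A `+` B] belongs to [N]; then [nu A = mu B] for every version [B] of [A].
    Hence it is enough to show that a countable partition [P] of [A] has
    versions forming a partition, with values in [dom mu], of some version [B]
    of [A]: the summation formula for [nu] is then an instance of the one for
    [mu].

    Having a version is compatible with differences and unions
    ([versionD], [versionU]), hence with intersections and finite unions; this
    also makes the domain of [nu] a ring. Countable unions are out of reach of
    this calculus, as [N] is only a ring, and this is where regularity enters.
    It encloses the trace of a member of [N] on a member of [dom mu] in a null
    set, and null sets may be added to or removed from a version. So [A]
    has a version [B] contained in [A] ([inner_version]), while each [P i] has a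
    version [G i] containing [P i `&` B] ([outer_version]). The sets [G i `&` B]
    are versions of the [P i] and their union is exactly [B]. Enumerating the
    indices and removing from each of these sets the finitely many earlier ones
    makes them disjoint, and they remain versions of the [P i], because the same
    operation leaves the disjoint sets [P i] unchanged. *)

Set Implicit Arguments.
Unset Strict Implicit.
Unset Printing Implicit Defensive.

Local Open Scope classical_set_scope.

Definition version (T V : Type) (mu : setmap T V) (N : set (set T))
    (A B : set T) : Prop :=
  dom mu B /\ N (A `+` B).

Lemma setring_setI (T : Type) (R : set (set T)) A B :
  setring R -> R A -> R B -> R (A `&` B).
Proof. by case=> _ _ RD RA RB; rewrite -setDD; exact/RD/RD. Qed.

Lemma seqDU_trivIset (T : Type) (Q : (set T)^nat) n :
  trivIset setT Q -> seqDU Q n = Q n.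
Proof.
move=> tQ; apply/setDidPl; rewrite setIC.
by rewrite (trivIset_bigsetUI (D := predT)) //; apply: sub_trivIset tQ.
Qed.

Section versions.
Context (T V : Type) (mu : setmap T V) (N : set (set T)).
Context (ringD : setring (dom mu)) (ringN : completion_ring mu N).
Implicit Types A B C M : set T.

Lemma version_refl B : dom mu B -> version mu N B B.
Proof. by case: ringN => -[N0 _ _] _ _ DB; split=> //; rewrite setYK. Qed.

Lemma null_version M : null_sets mu M -> version mu N set0 M.
Proof. by case: ringN => _ _ <- [NM DM]; split=> //; rewrite setYC setY0. Qed.

(** A completion ring need not be hereditary, yet it absorbs intersections with
    every set that has a version. *)
Lemma completion_ringI A B M : version mu N A B -> N M -> N (M `&` A).
Proof.
case: ringN => rN NI _ [DB NAB] NM.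
have -> : M `&` A = (M `&` B) `+` (M `&` (A `+` B)).
  rewrite predeqE => x /=.
  by case: (pselect (A x)); case: (pselect (B x)); tauto.
by apply: setring_setY => //; [exact: NI | exact: setring_setI].
Qed.

Lemma versionD A1 B1 A2 B2 : version mu N A1 B1 -> version mu N A2 B2 ->
  version mu N (A1 `\` A2) (B1 `\` B2).
Proof.
case: ringD ringN => _ _ DD [rN NI _] [DB1 NAB1] v2.
have [DB2 NAB2] := v2.
split; first exact: DD.
(* Exchange [A1] for [B1] first, then [A2] for [B2]. *)
have -> : (A1 `\` A2) `+` (B1 `\` B2) =
    ((A1 `+` B1) `\` ((A1 `+` B1) `&` A2)) `+` ((A2 `+` B2) `&` B1).
  rewrite predeqE => x /=.
  case: (pselect (A1 x)); case: (pselect (A2 x));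
  case: (pselect (B1 x)); case: (pselect (B2 x)); tauto.
apply: setring_setY => //; last exact: NI.
by case: rN => _ _ ND; apply: ND => //; exact: completion_ringI v2 NAB1.
Qed.

Lemma versionU A1 B1 A2 B2 : version mu N A1 B1 -> version mu N A2 B2 ->
  version mu N (A1 `|` A2) (B1 `|` B2).
Proof.
case: ringD ringN => _ DU _ [rN NI _] [DB1 NAB1] v2.
have [DB2 NAB2] := v2.
split; first exact: DU.
have -> : (A1 `|` A2) `+` (B1 `|` B2) =
    ((A1 `+` B1) `\` ((A1 `+` B1) `&` A2)) `+`
    ((A2 `+` B2) `\` ((A2 `+` B2) `&` B1)).
  rewrite predeqE => x /=.
  case: (pselect (A1 x)); case: (pselect (A2 x));
  case: (pselect (B1 x)); case: (pselect (B2 x)); tauto.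
case: (rN) => _ _ ND; apply: setring_setY => //; apply: ND => //.
- exact: completion_ringI v2 NAB1.
- exact: NI.
Qed.

Lemma versionI A1 B1 A2 B2 : version mu N A1 B1 -> version mu N A2 B2 ->
  version mu N (A1 `&` A2) (B1 `&` B2).
Proof. by move=> v1 v2; rewrite -!setDD; apply: versionD (versionD _ _). Qed.

Lemma version_seqDU (Q F : (set T)^nat) :
  (forall n, version mu N (Q n) (F n)) ->
  forall n, version mu N (seqDU Q n) (seqDU F n).
Proof.
move=> QF n; apply: versionD => //.
apply: (big_ind2 (version mu N)) => //; last by move=> *; exact: versionU.
by apply: version_refl; case: ringD.
Qed.

Lemma setring_completion : setring (dom (completion mu N)).
Proof.
split.
- have D0 : dom mu set0 by case: ringD.
  by exists set0 => //; case: (version_refl D0).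
- move=> A1 A2 [B1 D1 N1] [B2 D2 N2]; exists (B1 `|` B2);
  by case: (versionU (conj D1 N1) (conj D2 N2)).
- move=> A1 A2 [B1 D1 N1] [B2 D2 N2]; exists (B1 `\` B2);
  by case: (versionD (conj D1 N1) (conj D2 N2)).
Qed.

Section regularity.
Context (regN : regular mu N).

Lemma regular_null_cover M C : N M -> dom mu C ->
  exists2 M', null_sets mu M' & M `&` C `<=` M'.
Proof.
case: ringN => _ NI _ NM DC; apply: regN; split; first exact: NI.
by exists C => // x [].
Qed.

(** The excess [B `\` A] is part of the trace of [A `+` B] on [B], which a null
    set encloses; that null set can be discarded from [B]. *)
Lemma inner_version A B : version mu N A B ->
  exists2 B', version mu N A B' & B' `<=` A.
Proof.
move=> vAB; have [DB NAB] := vAB.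
have [M nullM subM] := regular_null_cover NAB DB.
exists (B `\` M).
  by rewrite -[A]setD0; exact: versionD (null_version nullM).
by move=> x [Bx nMx]; apply: contrapT => nAx; apply/nMx/subM; split=> //; right.
Qed.

(** Dually, what [B] misses of [A `&` C] lies in the trace of [A `+` B] on [C]. The
    bound [C] is essential: [A] itself need not be contained in any member of
    [dom mu]. *)
Lemma outer_version A B C : version mu N A B -> dom mu C ->
  exists2 G, version mu N A G & A `&` C `<=` G.
Proof.
move=> vAB DC; have [DB NAB] := vAB.
have [M nullM subM] := regular_null_cover NAB DC.
exists (B `|` M).
  by rewrite -[A]setU0; exact: versionU (null_version nullM).
move=> x [Ax Cx]; case: (pselect (B x)) => [|nBx]; first by left.
by right; apply: subM; split=> //; left.
Qed.

(** The inner version of [A] and the outer versions of the [P i] turn a partition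
    up to [N] into an exact cover. Along an enumeration of [I] only finitely
    many earlier sets have to be removed at each index, so that making the cover
    disjoint stays within the operations that preserve versions. *)
Lemma partition_versions (I : countType) (P : I -> set T) (A : set T) :
  Delta (dom mu) N A -> (forall i, Delta (dom mu) N (P i)) ->
  family_partition P A ->
  exists B (H : I -> set T), [/\ version mu N A B,
    forall i, version mu N (P i) (H i) & family_partition H B].
Proof.
move=> [B0 DB0 NB0] DP [trivP PA].
have [B vAB BA] : exists2 B, version mu N A B & B `<=` A.
  by apply: (@inner_version A B0).
have DB : dom mu B by case: vAB.
have /choice[G PG] : forall i, exists G,
    version mu N (P i) G /\ P i `&` B `<=` G.
  move=> i; have [Bi DBi NBi] := DP i.
  by have [G ? ?] := @outer_version (P i) Bi B (conj DBi NBi) DB; exists G.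
(* The two families are read along the enumeration of [I], with [set0] at the
   numbers that code no index. *)
pose Q (n : nat) := oapp P set0 (@pickle_inv I n).
pose F (n : nat) := oapp (fun i => G i `&` B) set0 (@pickle_inv I n).
have QF n : version mu N (Q n) (F n).
  rewrite /Q /F; case: pickle_inv => [i|] /=; last first.
    by apply: version_refl; case: ringD.
  have -> : P i = P i `&` A by rewrite setIidl// -PA; exact: bigcup_sup.
  by apply: versionI => //; exact: (PG i).1.
have trivQ : trivIset setT Q.
  move=> m n _ _; rewrite /Q; have := @pickle_invK I m.
  have := @pickle_invK I n.
  case: pickle_inv => [j|] /= jn; case: pickle_inv => [i|] /= im [x []//].
  move=> Pix Pjx; rewrite -jn -im; congr pickle.
  by apply: trivP => //; exists x.
exists B, (fun i => seqDU F (pickle i)); split=> //.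
- move=> i; have := version_seqDU QF (pickle i).
  by rewrite (seqDU_trivIset _ trivQ) /Q pickleK_inv.
- split.
    move=> i j _ _ Fij; apply: (pcan_inj pickleK_inv).
    by apply: (trivIset_seqDU F) Fij.
  apply/seteqP; split=> [x [i _ Fx]|x Bx].
    by have := subset_seqDU Fx; rewrite /F pickleK_inv => -[].
  have [i _ Pix] : (\bigcup_i P i) x by rewrite PA; exact: BA.
  have : (\bigcup_n F n) x.
    exists (pickle i) => //; rewrite /F pickleK_inv; split=> //.
    exact: (PG i).2.
  rewrite seqDU_bigcup_eq => -[n _ Fnx].
  have := subset_seqDU Fnx; rewrite /F; have := @pickle_invK I n.
  by case: pickle_inv => [j|] //= jn _; exists j => //; rewrite jn.
Qed.

End regularity.
End versions.

Theorem theorem5p4 (T : Type) (V : topologicalZmodType)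
    (mu : setmap T V) (N : set (set T)) :
  hausdorff_space V ->
  sigma_content mu ->
  completion_ring mu N ->
  regular mu N ->
  sigma_content (completion mu N).
Proof.
move=> hV scmu ringN regN.
have acmu := sigma_content_admits_completion hV scmu.
have [ringD mu_sum] := scmu.
split=> [|A I P DA DP PA]; first exact: setring_completion.
have [B [H [[DB NB] PH HB]]] := partition_versions ringD ringN regN DA DP PA.
rewrite (completionE acmu ringN DB NB).
have -> : (fun i => completion mu N (P i)) = (fun i => mu (H i)).
  apply/funext => i; have [DH NH] := PH i.
  exact: completionE acmu ringN DH NH.
by apply: mu_sum => // i; have [] := PH i.
Qed.
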